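(* Let $\mathbf{C}$ be a category with a class $W$ of arrows satisfying the conditions CF1, CF2, CF3, let $\mathcal{D}$ be a bicategory and let $F\colon\mathbf{C}\to\mathcal{D}$ be a homomorphism of bicategories. Then $F$ is a $W$-homomorphism (i.e. sends the elements of $W$ to internal equivalences) if and only if $\mathbf{Dbl}(F)\colon\mathbf{Dbl}(\mathbf{C})\to\mathbf{Dbl}(\mathcal{D})$ sends every $W$-doubly marked path in $\mathbf{Dbl}(\mathbf{C})$ to a precompanion in $\mathbf{Dbl}(\mathcal{D})$.
   Context: Conditions on $W$: CF1: $W$ contains all isomorphisms and is closed under composition. CF2: for $f\colon C\to B$ and $w\colon A\to B$ with $w\in W$ there are $\bar f\colon D\to A$ and $\bar w\colon D\to C$ with $\bar w\in W$ and $w\bar f=f\bar w$. CF3: if $w\in W$ and $wf=wg$ there is $\tilde w\in W$ with $f\tilde w=g\tilde w$. A category is regarded as a bicategory with only identity 2-cells. In a double category, $\circ$ is horizontal composition, $\cdot$ vertical composition ($\beta\cdot\alpha$ has $\alpha$ on top), $\mathrm{Id}_A$ and $1_A$ are horizontal and vertical identity arrows, $\mathrm{id}_v$ the horizontal identity cell on a vertical arrow $v$, $1_f$ the vertical identity cell on a horizontal arrow $f$. A horizontal arrow $f\colon A\to B$ *is a companion* (has a vertical companion) if there are a vertical arrow $v\colon A\to B$ and cells $\psi$ (top $\mathrm{Id}_A$, bottom $f$, left $1_A$, right $v$) and $\chi$ (top $f$, bottom $\mathrm{Id}_B$, left $v$, right $1_B$) with $\chi\circ\psi=1_f$ and $\chi\cdot\psi=\mathrm{id}_v$.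 A horizontal arrow $f$ is a *left precompanion* if there are horizontal arrows $f'\colon A'\to B'$, $r_f\colon B'\to C$ and a vertically invertible double cell with top $f$ and bottom $f'$ such that $r_f\circ f'$ is a companion; a *right precompanion* if there are horizontal arrows $f''\colon A''\to B''$, $l_f\colon D\to A''$ and a vertically invertible double cell with top $f$ and bottom $f''$ such that $f''\circ l_f$ is a companion; a *precompanion* if both. The double category $\mathbf{Dbl}(\mathcal{B})$ for a bicategory $\mathcal{B}$: choose a composite $\varphi_{f_1,\dots,f_n}$ (a bracketed composition) of each finite path of composable arrows, the empty path at $A$ having composite $1_A$. Objects: paths $A_0\xrightarrow{f_1}\cdots\xrightarrow{f_n}A_n$ with a marked index $i_0$. There is a unique vertical arrow between two objects iff their marked objects are equal, and none otherwise. Horizontal arrows: paths with two marked indices $i_0\le i_1$, with domain the path marked at $i_0$ and codomain the path marked at $i_1$; $(i_0,i_1)$ followed by $(i_1,i_2)$ on the same path is $(i_0,i_2)$. A double cell from $(f_1,\dots,f_n;i_0,i_1)$ to $(g_1,\dots,g_m;j_0,j_1)$ exists only if $A_{i_0}=B_{j_0}$ and $A_{i_1}=B_{j_1}$, and is a 2-cell $\varphi_{f_{i_0+1},\dots,f_{i_1}}\Rightarrow\varphi_{g_{j_0+1},\dots,g_{j_1}}$ in $\mathcal{B}$. Vertical composition is that of 2-cells; horizontal composition is horizontal composition of 2-cells conjugated by the canonical coherence isomorphisms between chosen composites. $\mathbf{Dbl}(F)$ applies $F$ to each arrow of a path, keeping the marks, and sends a 2-cell $\alpha$ to $F\alpha$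 conjugated by the coherence isomorphisms between $F$ of a chosen composite and the chosen composite of the images. A *$W$-doubly marked path* is a horizontal arrow $(f_1,\dots,f_n;i_0,i_1)$ of $\mathbf{Dbl}(\mathbf{C})$ with $f_{i_1}\circ\cdots\circ f_{i_0+1}\in W$. *)

(* Defs.v *)
From Stdlib Require Import ssreflect ProofIrrelevance.

Set Implicit Arguments.
Unset Strict Implicit.
Unset Printing Implicit Defensive.
Set Asymmetric Patterns.

Declare Scope bicat_scope.
Open Scope bicat_scope.
Reserved Notation "g ∘ f" (at level 40, left associativity).
Reserved Notation "b • a" (at level 45, right associativity).
Reserved Notation "b ⋆ a" (at level 38, left associativity).

Record Category := {
  cob :> Type;
  chom : cob -> cob -> Type;
  cone : forall A, chom A A;
  ccomp : forall A B C, chom B C -> chom A B -> chom A C;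
  ccompA : forall A B C D (h : chom C D) (g : chom B C) (f : chom A B),
    ccomp (ccomp h g) f = ccomp h (ccomp g f);
  ccomp1l : forall A B (f : chom A B), ccomp (cone B) f = f;
  ccomp1r : forall A B (f : chom A B), ccomp f (cone A) = f }.
Arguments chom {_}.
Arguments cone {_}.
Arguments ccomp {_ _ _ _}.

Definition is_iso (C : Category) (A B : C) (f : chom A B) : Prop :=
  exists g : chom B A, ccomp g f = cone A /\ ccomp f g = cone B.

Definition arrow_class (C : Category) := forall A B : C, chom A B -> Prop.

Definition CF1 (C : Category) (W : arrow_class C) : Prop :=
  (forall (A B : C) (f : chom A B), is_iso f -> W A B f) /\
  (forall (X Y Z : C) (g : chom Y Z) (f : chom X Y),
     W Y Z g -> W X Y f -> W X Z (ccomp g f)).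

Definition CF2 (C : Category) (W : arrow_class C) : Prop :=
  forall (A B X : C) (f : chom X B) (w : chom A B), W A B w ->
  exists (D : C) (f' : chom D A) (w' : chom D X),
    W D X w' /\ ccomp w f' = ccomp f w'.

Definition CF3 (C : Category) (W : arrow_class C) : Prop :=
  forall (X A B : C) (w : chom A B) (f g : chom X A),
    W A B w -> ccomp w f = ccomp w g ->
  exists (D : C) (w' : chom D X), W D X w' /\ ccomp f w' = ccomp g w'.

(* [assoc h g f : (h ∘ g) ∘ f => h ∘ (g ∘ f)] *)
Record Bicategory := {
  ob :> Type;
  hom : ob -> ob -> Type;
  cell2 : forall A B, hom A B -> hom A B -> Type;
  one : forall A, hom A A;
  comp : forall A B C, hom B C -> hom A B -> hom A C
    where "g ∘ f" := (comp g f);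
  id2 : forall A B (f : hom A B), cell2 f f;
  vcomp : forall A B (f g h : hom A B), cell2 g h -> cell2 f g -> cell2 f h
    where "b • a" := (vcomp b a);
  hcomp : forall A B C (f f' : hom A B) (g g' : hom B C),
    cell2 g g' -> cell2 f f' -> cell2 (g ∘ f) (g' ∘ f')
    where "b ⋆ a" := (hcomp b a);
  assoc : forall A B C D (h : hom C D) (g : hom B C) (f : hom A B),
    cell2 ((h ∘ g) ∘ f) (h ∘ (g ∘ f));
  assoc_inv : forall A B C D (h : hom C D) (g : hom B C) (f : hom A B),
    cell2 (h ∘ (g ∘ f)) ((h ∘ g) ∘ f);
  lunit : forall A B (f : hom A B), cell2 (one B ∘ f) f;
  lunit_inv : forall A B (f : hom A B), cell2 f (one B ∘ f);
  runit : forall A B (f : hom A B), cell2 (f ∘ one A) f;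
  runit_inv : forall A B (f : hom A B), cell2 f (f ∘ one A);
  vcompA : forall A B (f g h k : hom A B)
      (c : cell2 h k) (b : cell2 g h) (a : cell2 f g),
    (c • b) • a = c • b • a;
  vcomp1l : forall A B (f g : hom A B) (a : cell2 f g), id2 g • a = a;
  vcomp1r : forall A B (f g : hom A B) (a : cell2 f g), a • id2 f = a;
  hcomp_id : forall A B C (g : hom B C) (f : hom A B),
    id2 g ⋆ id2 f = id2 (g ∘ f);
  interchange : forall A B C (f f' f'' : hom A B) (g g' g'' : hom B C)
      (b' : cell2 g' g'') (b : cell2 g g') (a' : cell2 f' f'') (a : cell2 f f'),
    (b' • b) ⋆ (a' • a) = (b' ⋆ a') • (b ⋆ a);
  assocK : forall A B C D (h : hom C D) (g : hom B C) (f : hom A B),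
    assoc_inv h g f • assoc h g f = id2 _;
  assocVK : forall A B C D (h : hom C D) (g : hom B C) (f : hom A B),
    assoc h g f • assoc_inv h g f = id2 _;
  lunitK : forall A B (f : hom A B), lunit_inv f • lunit f = id2 _;
  lunitVK : forall A B (f : hom A B), lunit f • lunit_inv f = id2 _;
  runitK : forall A B (f : hom A B), runit_inv f • runit f = id2 _;
  runitVK : forall A B (f : hom A B), runit f • runit_inv f = id2 _;
  assoc_nat : forall A B C D (h h' : hom C D) (g g' : hom B C) (f f' : hom A B)
      (c : cell2 h h') (b : cell2 g g') (a : cell2 f f'),
    assoc h' g' f' • ((c ⋆ b) ⋆ a) = (c ⋆ (b ⋆ a)) • assoc h g f;
  lunit_nat : forall A B (f f' : hom A B) (a : cell2 f f'),
    lunit f' • (id2 (one B) ⋆ a) = a • lunit f;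
  runit_nat : forall A B (f f' : hom A B) (a : cell2 f f'),
    runit f' • (a ⋆ id2 (one A)) = a • runit f;
  pentagon : forall A B C D E
      (k : hom D E) (h : hom C D) (g : hom B C) (f : hom A B),
    (id2 k ⋆ assoc h g f) • assoc k (h ∘ g) f • (assoc k h g ⋆ id2 f)
    = assoc k h (g ∘ f) • assoc (k ∘ h) g f;
  triangle : forall A B C (g : hom B C) (f : hom A B),
    (id2 g ⋆ lunit f) • assoc g (one B) f = runit g ⋆ id2 f }.
Arguments hom {_}.
Arguments cell2 {_ _ _}.
Arguments one {_}.
Arguments comp {_ _ _ _}.
Arguments id2 {_ _ _}.
Arguments vcomp {_ _ _ _ _ _}.
Arguments hcomp {_ _ _ _ _ _ _ _}.
Arguments assoc {_ _ _ _ _}.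
Arguments assoc_inv {_ _ _ _ _}.
Arguments lunit {_ _ _}.
Arguments lunit_inv {_ _ _}.
Arguments runit {_ _ _}.
Arguments runit_inv {_ _ _}.
Notation "g ∘ f" := (comp g f) : bicat_scope.
Notation "b • a" := (vcomp b a) : bicat_scope.
Notation "b ⋆ a" := (hcomp b a) : bicat_scope.

Record iso2 (B : Bicategory) (X Y : B) (f g : hom X Y) := Iso2 {
  fwd :> cell2 f g;
  bwd : cell2 g f;
  bwdK : bwd • fwd = id2 f;
  fwdK : fwd • bwd = id2 g }.

Definition internal_equivalence (B : Bicategory) (X Y : B) (f : hom X Y) : Prop :=
  exists g : hom Y X,
    inhabited (iso2 (g ∘ f) (one X)) /\ inhabited (iso2 (f ∘ g) (one Y)).

(* The 2-cells of a category regarded as a bicategory are the equality proofs. *)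
Definition locally_discrete (C : Category) : Bicategory.
Proof.
unshelve refine {|
  ob := C;
  hom := @chom C;
  cell2 := fun A B f g => f = g;
  one := @cone C;
  comp := @ccomp C;
  id2 := fun A B f => eq_refl;
  vcomp := fun A B f g h b a => eq_trans a b;
  hcomp := fun A B X f f' g g' b a => f_equal2 ccomp b a;
  assoc := fun A B X D h g f => ccompA h g f;
  assoc_inv := fun A B X D h g f => eq_sym (ccompA h g f);
  lunit := fun A B f => ccomp1l f;
  lunit_inv := fun A B f => eq_sym (ccomp1l f);
  runit := fun A B f => ccomp1r f;
  runit_inv := fun A B f => eq_sym (ccomp1r f) |};
intros; apply proof_irrelevance.
Defined.

Record Homomorphism (B D : Bicategory) := {
  F0 :> B -> D;
  F1 : forall X Y : B, hom X Y -> hom (F0 X) (F0 Y);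
  F2 : forall (X Y : B) (f g : hom X Y), cell2 f g -> cell2 (F1 f) (F1 g);
  Fcomp : forall (X Y Z : B) (g : hom Y Z) (f : hom X Y),
    iso2 (F1 g ∘ F1 f) (F1 (g ∘ f));
  Fone : forall X : B, iso2 (one (F0 X)) (F1 (one X));
  F2_id : forall (X Y : B) (f : hom X Y), F2 (id2 f) = id2 (F1 f);
  F2_vcomp : forall (X Y : B) (f g h : hom X Y) (b : cell2 g h) (a : cell2 f g),
    F2 (b • a) = F2 b • F2 a;
  Fcomp_nat : forall (X Y Z : B) (g g' : hom Y Z) (f f' : hom X Y)
      (b : cell2 g g') (a : cell2 f f'),
    Fcomp g' f' • (F2 b ⋆ F2 a) = F2 (b ⋆ a) • Fcomp g f;
  Fassoc : forall (X Y Z T : B) (h : hom Z T) (g : hom Y Z) (f : hom X Y),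
    F2 (assoc h g f) • Fcomp (h ∘ g) f • (Fcomp h g ⋆ id2 (F1 f))
    = Fcomp h (g ∘ f) • (id2 (F1 h) ⋆ Fcomp g f) • assoc (F1 h) (F1 g) (F1 f);
  Flunit : forall (X Y : B) (f : hom X Y),
    F2 (lunit f) • Fcomp (one Y) f • (Fone Y ⋆ id2 (F1 f)) = lunit (F1 f);
  Frunit : forall (X Y : B) (f : hom X Y),
    F2 (runit f) • Fcomp f (one X) • (id2 (F1 f) ⋆ Fone X) = runit (F1 f) }.
Arguments F1 {_ _} _ {_ _}.
Arguments F2 {_ _} _ {_ _ _ _}.
Arguments Fcomp {_ _} _ {_ _ _}.
Arguments Fone {_ _}.

Definition W_homomorphism (C : Category) (W : arrow_class C) (D : Bicategory)
    (F : Homomorphism (locally_discrete C) D) : Prop :=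
  forall (A B : C) (w : chom A B), W A B w ->
    internal_equivalence (@F1 _ _ F A B w).

Reserved Notation "g ∘h f" (at level 40, left associativity).
Reserved Notation "w ∘v v" (at level 40, left associativity).
Reserved Notation "b ∘c a" (at level 40, left associativity).
Reserved Notation "b ⋅ a" (at level 45, right associativity).

(* Cells in a common frame of objects but with possibly different (provably
   equal) boundary arrows are compared after packing them with their boundary. *)
Record square_of (O : Type) (hor ver : O -> O -> Type)
    (dcell : forall A B A' B', hor A B -> ver A A' -> ver B B' -> hor A' B' -> Type)
    (A B A' B' : O) := Square {
  top : hor A B;
  left : ver A A';
  right : ver B B';
  bottom : hor A' B';
  inner : dcell A B A' B' top left right bottom }.
Arguments Square {_ _ _} dcell {_ _ _ _ _ _ _ _}.

(* [dcell f v w g] is the type of cells with top [f], left [v], right [w] and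
   bottom [g]; [hid A] and [vid A] are Id_A and 1_A, [cell_hid v] and [cell_vid f]
   are id_v and 1_f. *)
Record DoubleCategory := {
  dob :> Type;
  hor : dob -> dob -> Type;
  ver : dob -> dob -> Type;
  dcell : forall A B A' B',
    hor A B -> ver A A' -> ver B B' -> hor A' B' -> Type;
  hid : forall A, hor A A;
  hcmp : forall A B C, hor B C -> hor A B -> hor A C
    where "g ∘h f" := (hcmp g f);
  vid : forall A, ver A A;
  vcmp : forall A B C, ver B C -> ver A B -> ver A C
    where "w ∘v v" := (vcmp w v);
  cell_hid : forall A A' (v : ver A A'), dcell (hid A) v v (hid A');
  cell_vid : forall A B (f : hor A B), dcell f (vid A) (vid B) f;
  cell_hcmp : forall A B C A' B' C' (f : hor A B) (g : hor B C)
      (u : ver A A') (v : ver B B') (w : ver C C')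
      (f' : hor A' B') (g' : hor B' C'),
    dcell g v w g' -> dcell f u v f' -> dcell (g ∘h f) u w (g' ∘h f')
    where "b ∘c a" := (cell_hcmp b a);
  cell_vcmp : forall A B A' B' A'' B'' (f : hor A B) (g : hor A' B')
      (h : hor A'' B'') (v : ver A A') (w : ver B B')
      (v' : ver A' A'') (w' : ver B' B''),
    dcell g v' w' h -> dcell f v w g -> dcell f (v' ∘v v) (w' ∘v w) h
    where "b ⋅ a" := (cell_vcmp b a);
  hcmpA : forall A B C D (h : hor C D) (g : hor B C) (f : hor A B),
    (h ∘h g) ∘h f = h ∘h (g ∘h f);
  hcmp1l : forall A B (f : hor A B), hid B ∘h f = f;
  hcmp1r : forall A B (f : hor A B), f ∘h hid A = f;
  vcmpA : forall A B C D (w : ver C D) (v : ver B C) (u : ver A B),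
    (w ∘v v) ∘v u = w ∘v (v ∘v u);
  vcmp1l : forall A B (v : ver A B), vid B ∘v v = v;
  vcmp1r : forall A B (v : ver A B), v ∘v vid A = v;
  cell_vcmpA : forall A B A' B' A'' B'' A3 B3
      (f : hor A B) (g : hor A' B') (h : hor A'' B'') (k : hor A3 B3)
      (v : ver A A') (w : ver B B') (v' : ver A' A'') (w' : ver B' B'')
      (v'' : ver A'' A3) (w'' : ver B'' B3)
      (c : dcell h v'' w'' k) (b : dcell g v' w' h) (a : dcell f v w g),
    Square dcell ((c ⋅ b) ⋅ a) = Square dcell (c ⋅ (b ⋅ a));
  cell_vcmp1l : forall A B A' B' (f : hor A B) (v : ver A A') (w : ver B B')
      (g : hor A' B') (a : dcell f v w g),
    Square dcell (cell_vid g ⋅ a) = Square dcell a;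
  cell_vcmp1r : forall A B A' B' (f : hor A B) (v : ver A A') (w : ver B B')
      (g : hor A' B') (a : dcell f v w g),
    Square dcell (a ⋅ cell_vid f) = Square dcell a;
  cell_hcmpA : forall A B C D A' B' C' D'
      (f : hor A B) (g : hor B C) (h : hor C D)
      (u : ver A A') (v : ver B B') (w : ver C C') (x : ver D D')
      (f' : hor A' B') (g' : hor B' C') (h' : hor C' D')
      (c : dcell h w x h') (b : dcell g v w g') (a : dcell f u v f'),
    Square dcell ((c ∘c b) ∘c a) = Square dcell (c ∘c (b ∘c a));
  cell_hcmp1l : forall A B A' B' (f : hor A B) (v : ver A A') (w : ver B B')
      (g : hor A' B') (a : dcell f v w g),
    Square dcell (cell_hid w ∘c a) = Square dcell a;
  cell_hcmp1r : forall A B A' B' (f : hor A B) (v : ver A A') (w : ver B B')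
      (g : hor A' B') (a : dcell f v w g),
    Square dcell (a ∘c cell_hid v) = Square dcell a;
  cell_interchange : forall A B C A' B' C' A'' B'' C''
      (f : hor A B) (g : hor B C) (f' : hor A' B') (g' : hor B' C')
      (f'' : hor A'' B'') (g'' : hor B'' C'')
      (u : ver A A') (v : ver B B') (w : ver C C')
      (u' : ver A' A'') (v' : ver B' B'') (w' : ver C' C'')
      (b' : dcell g' v' w' g'') (a' : dcell f' u' v' f'')
      (b : dcell g v w g') (a : dcell f u v f'),
    (b' ∘c a') ⋅ (b ∘c a) = (b' ⋅ b) ∘c (a' ⋅ a);
  cell_hid_vcmp : forall A A' A'' (v : ver A A') (v' : ver A' A''),
    cell_hid (v' ∘v v) = cell_hid v' ⋅ cell_hid v;
  cell_vid_hcmp : forall A B C (f : hor A B) (g : hor B C),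
    cell_vid (g ∘h f) = cell_vid g ∘c cell_vid f;
  cell_hid_vid : forall A, cell_hid (vid A) = cell_vid (hid A) }.
Arguments hor {_}.
Arguments ver {_}.
Arguments dcell {_ _ _ _ _}.
Arguments hid {_}.
Arguments hcmp {_ _ _ _}.
Arguments vid {_}.
Arguments vcmp {_ _ _ _}.
Arguments cell_hid {_ _ _}.
Arguments cell_vid {_ _ _}.
Arguments cell_hcmp {_ _ _ _ _ _ _ _ _ _ _ _ _ _}.
Arguments cell_vcmp {_ _ _ _ _ _ _ _ _ _ _ _ _ _}.
Notation "g ∘h f" := (hcmp g f) : bicat_scope.
Notation "w ∘v v" := (vcmp w v) : bicat_scope.
Notation "b ∘c a" := (cell_hcmp b a) : bicat_scope.
Notation "b ⋅ a" := (cell_vcmp b a) : bicat_scope.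

Definition square {DD : DoubleCategory} {A B A' B' : DD} {f : hor A B}
    {v : ver A A'} {w : ver B B'} {g : hor A' B'} (a : dcell f v w g) :
    square_of (@dcell DD) A B A' B' :=
  Square (@dcell DD) a.

Section Companions.
Variable DD : DoubleCategory.

Definition is_companion (A B : DD) (f : hor A B) : Prop :=
  exists (v : ver A B) (psi : dcell (hid A) (vid A) v f)
         (chi : dcell f v (vid B) (hid B)),
    square (chi ∘c psi) = square (cell_vid f) /\
    square (chi ⋅ psi) = square (cell_hid v).

Definition vertically_invertible (A B A' B' : DD) (f : hor A B) (v : ver A A')
    (w : ver B B') (g : hor A' B') (a : dcell f v w g) : Prop :=
  exists (v' : ver A' A) (w' : ver B' B) (b : dcell g v' w' f),
    square (b ⋅ a) = square (cell_vid f) /\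
    square (a ⋅ b) = square (cell_vid g).

Definition left_precompanion (A B : DD) (f : hor A B) : Prop :=
  exists (A' B' C : DD) (f' : hor A' B') (r : hor B' C)
         (v : ver A A') (w : ver B B') (a : dcell f v w f'),
    vertically_invertible a /\ is_companion (r ∘h f').

Definition right_precompanion (A B : DD) (f : hor A B) : Prop :=
  exists (A'' B'' D : DD) (f'' : hor A'' B'') (l : hor D A'')
         (v : ver A A'') (w : ver B B'') (a : dcell f v w f''),
    vertically_invertible a /\ is_companion (f'' ∘h l).

Definition precompanion (A B : DD) (f : hor A B) : Prop :=
  left_precompanion f /\ right_precompanion f.

End Companions.

Record DoubleFunctor (DD EE : DoubleCategory) := {
  D0 :> DD -> EE;
  Dh : forall A B : DD, hor A B -> hor (D0 A) (D0 B);
  Dv : forall A B : DD, ver A B -> ver (D0 A) (D0 B);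
  Dc : forall (A B A' B' : DD) (f : hor A B) (v : ver A A') (w : ver B B')
      (g : hor A' B'), dcell f v w g -> dcell (Dh f) (Dv v) (Dv w) (Dh g);
  Dh_id : forall A : DD, Dh (hid A) = hid (D0 A);
  Dh_cmp : forall (A B C : DD) (g : hor B C) (f : hor A B),
    Dh (g ∘h f) = Dh g ∘h Dh f;
  Dv_id : forall A : DD, Dv (vid A) = vid (D0 A);
  Dv_cmp : forall (A B C : DD) (w : ver B C) (v : ver A B),
    Dv (w ∘v v) = Dv w ∘v Dv v;
  Dc_hid : forall (A A' : DD) (v : ver A A'),
    square (Dc (cell_hid v)) = square (cell_hid (Dv v));
  Dc_vid : forall (A B : DD) (f : hor A B),
    square (Dc (cell_vid f)) = square (cell_vid (Dh f));
  Dc_hcmp : forall (A B C A' B' C' : DD) (f : hor A B) (g : hor B C)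
      (u : ver A A') (v : ver B B') (w : ver C C')
      (f' : hor A' B') (g' : hor B' C')
      (b : dcell g v w g') (a : dcell f u v f'),
    square (Dc (b ∘c a)) = square (Dc b ∘c Dc a);
  Dc_vcmp : forall (A B A' B' A'' B'' : DD) (f : hor A B) (g : hor A' B')
      (h : hor A'' B'') (v : ver A A') (w : ver B B')
      (v' : ver A' A'') (w' : ver B' B'')
      (b : dcell g v' w' h) (a : dcell f v w g),
    square (Dc (b ⋅ a)) = square (Dc b ⋅ Dc a) }.
Arguments Dh {_ _} _ {_ _}.
Arguments Dv {_ _} _ {_ _}.
Arguments Dc {_ _} _ {_ _ _ _ _ _ _ _}.

Section Isos.
Variable B : Bicategory.

Definition iso_id (X Y : B) (f : hom X Y) : iso2 f f :=
  Iso2 (vcomp1l (id2 f)) (vcomp1l (id2 f)).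

Definition iso_inv (X Y : B) (f g : hom X Y) (i : iso2 f g) : iso2 g f :=
  Iso2 (fwdK i) (bwdK i).

Lemma iso_cat_proof (X Y : B) (f g h : hom X Y) (j : iso2 g h) (i : iso2 f g) :
  (bwd i • bwd j) • j • i = id2 f.
Proof. by rewrite vcompA -(vcompA (bwd j)) bwdK vcomp1l bwdK. Qed.

Definition iso_cat (X Y : B) (f g h : hom X Y) (j : iso2 g h) (i : iso2 f g) :
    iso2 f h :=
  Iso2 (iso_cat_proof j i) (iso_cat_proof (iso_inv i) (iso_inv j)).

Lemma iso_whisk_proof (X Y Z : B) (f f' : hom X Y) (g g' : hom Y Z)
    (j : iso2 g g') (i : iso2 f f') :
  (bwd j ⋆ bwd i) • (j ⋆ i) = id2 (g ∘ f).
Proof. by rewrite -interchange !bwdK hcomp_id. Qed.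

Definition iso_whisk (X Y Z : B) (f f' : hom X Y) (g g' : hom Y Z)
    (j : iso2 g g') (i : iso2 f f') : iso2 (g ∘ f) (g' ∘ f') :=
  Iso2 (iso_whisk_proof j i) (iso_whisk_proof (iso_inv j) (iso_inv i)).

Definition iso_assoc (X Y Z T : B) (h : hom Z T) (g : hom Y Z) (f : hom X Y) :
    iso2 ((h ∘ g) ∘ f) (h ∘ (g ∘ f)) :=
  Iso2 (assocK h g f) (assocVK h g f).
Definition iso_lunit (X Y : B) (f : hom X Y) : iso2 (one Y ∘ f) f :=
  Iso2 (lunitK f) (lunitVK f).
Definition iso_runit (X Y : B) (f : hom X Y) : iso2 (f ∘ one X) f :=
  Iso2 (runitK f) (runitVK f).

Lemma iso_monic (X Y : B) (f g h : hom X Y) (i : iso2 g h) (a b : cell2 f g) :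
  i • a = i • b -> a = b.
Proof.
move=> E; rewrite -(vcomp1l a) -(vcomp1l b) -(bwdK i) !vcompA.
by rewrite E.
Qed.

Lemma iso_epic (X Y : B) (f g h : hom X Y) (i : iso2 f g) (a b : cell2 g h) :
  a • i = b • i -> a = b.
Proof.
move=> E; rewrite -(vcomp1r a) -(vcomp1r b) -(fwdK i) -!vcompA.
by rewrite E.
Qed.

Lemma bwdKr (X Y : B) (f g h : hom X Y) (i : iso2 g h) (a : cell2 f g) :
  bwd i • i • a = a.
Proof. by rewrite -vcompA bwdK vcomp1l. Qed.
Lemma fwdKr (X Y : B) (f g h : hom X Y) (i : iso2 g h) (a : cell2 f h) :
  i • bwd i • a = a.
Proof. by rewrite -vcompA fwdK vcomp1l. Qed.

Lemma whisk_rl (X Y Z : B) (f f' : hom X Y) (g g' : hom Y Z)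
    (b : cell2 g g') (a : cell2 f f') :
  (id2 g' ⋆ a) • (b ⋆ id2 f) = b ⋆ a.
Proof. by rewrite -interchange vcomp1l vcomp1r. Qed.
Lemma whisk_lr (X Y Z : B) (f f' : hom X Y) (g g' : hom Y Z)
    (b : cell2 g g') (a : cell2 f f') :
  (b ⋆ id2 f') • (id2 g ⋆ a) = b ⋆ a.
Proof. by rewrite -interchange vcomp1l vcomp1r. Qed.
Lemma whisk_ll (X Y Z : B) (f f' f'' : hom X Y) (g : hom Y Z)
    (a' : cell2 f' f'') (a : cell2 f f') :
  id2 g ⋆ (a' • a) = (id2 g ⋆ a') • (id2 g ⋆ a).
Proof. by rewrite -interchange vcomp1l. Qed.
Lemma whisk_rr (X Y Z : B) (f : hom X Y) (g g' g'' : hom Y Z)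
    (b' : cell2 g' g'') (b : cell2 g g') :
  (b' • b) ⋆ id2 f = (b' ⋆ id2 f) • (b ⋆ id2 f).
Proof. by rewrite -interchange vcomp1l. Qed.

Lemma lwhisk_inj (X Y : B) (f f' : hom X Y) (a b : cell2 f f') :
  id2 (one Y) ⋆ a = id2 (one Y) ⋆ b -> a = b.
Proof.
by move=> E; apply: (@iso_epic _ _ _ _ _ (iso_lunit f)); rewrite /= -!lunit_nat E.
Qed.
Lemma rwhisk_inj (X Y : B) (f f' : hom X Y) (a b : cell2 f f') :
  a ⋆ id2 (one X) = b ⋆ id2 (one X) -> a = b.
Proof.
by move=> E; apply: (@iso_epic _ _ _ _ _ (iso_runit f)); rewrite /= -!runit_nat E.
Qed.

Lemma lunit_comp (X Y Z : B) (g : hom Y Z) (f : hom X Y) :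
  lunit (g ∘ f) • assoc (one Z) g f = lunit g ⋆ id2 f.
Proof.
apply: lwhisk_inj.
apply: (@iso_epic _ _ _ _ _ (iso_cat (iso_assoc (one Z) (one Z ∘ g) f)
  (iso_whisk (iso_assoc (one Z) (one Z) g) (iso_id f)))) => /=.
rewrite whisk_ll vcompA pentagon -vcompA triangle.
rewrite -vcompA -assoc_nat vcompA -whisk_rr triangle assoc_nat.
by rewrite hcomp_id.
Qed.

Lemma runit_comp (X Y Z : B) (g : hom Y Z) (f : hom X Y) :
  (id2 g ⋆ runit f) • assoc g f (one X) = runit (g ∘ f).
Proof.
apply: rwhisk_inj; apply: (@iso_monic _ _ _ _ _ (iso_assoc g f (one X))) => /=.
rewrite -(triangle (g ∘ f)) -hcomp_id -vcompA assoc_nat vcompA -pentagon.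
by rewrite -vcompA -whisk_ll triangle -vcompA -assoc_nat whisk_rr vcompA.
Qed.

Lemma lunit_runit_one (X : B) : lunit (one X) = runit (one X).
Proof.
apply: rwhisk_inj; rewrite -lunit_comp -triangle; congr (_ • _).
by apply: (@iso_monic _ _ _ _ _ (iso_lunit (one X))); rewrite /= lunit_nat.
Qed.

End Isos.

Section Paths.
Variables (T : Type) (H : T -> T -> Type).

Inductive path (A : T) : T -> Type :=
| pnil : path A A
| pcons : forall B C, H A B -> path B C -> path A C.

Fixpoint papp (A B C : T) (p : path A B) : path B C -> path A C :=
  match p with
  | pnil => fun q => q
  | pcons _ _ f p' => fun q => pcons f (papp p' q)
  end.

Lemma pappA (A B C D : T) (p : path A B) (q : path B C) (r : path C D) :
  papp (papp p q) r = papp p (papp q r).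
Proof. by elim: p q => //= A' B' C' f p IH q; rewrite IH. Qed.

Lemma papp_nil (A B : T) (p : path A B) : papp p (pnil B) = p.
Proof. by elim: p => //= A' B' C' f p ->. Qed.

(* Bracketings of a (necessarily nonempty) path. *)
Inductive bracketing : forall A B, path A B -> Type :=
| br_arrow : forall A B (f : H A B), bracketing (pcons f (pnil B))
| br_comp : forall A B C (p : path A B) (q : path B C),
    bracketing p -> bracketing q -> bracketing (papp p q).

End Paths.
Arguments pnil {_ _}.

Fixpoint pmap (T T' : Type) (H : T -> T -> Type) (H' : T' -> T' -> Type)
    (F : T -> T') (Fh : forall A B, H A B -> H' (F A) (F B))
    (A B : T) (p : path H A B) : path H' (F A) (F B) :=
  match p with
  | pnil => pnil (F A)
  | pcons _ _ f p' => pcons (Fh _ _ f) (pmap Fh p')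
  end.

Lemma pmap_app (T T' : Type) (H : T -> T -> Type) (H' : T' -> T' -> Type)
    (F : T -> T') (Fh : forall A B, H A B -> H' (F A) (F B))
    (A B C : T) (p : path H A B) (q : path H B C) :
  papp (pmap Fh p) (pmap Fh q) = pmap Fh (papp p q).
Proof. by elim: p q => //= A' B' C' f p IH q; rewrite IH. Qed.

(* The empty path is composed to the identity, see [phi]. *)
Definition choice_of_composites (B : Bicategory) :=
  forall (X Y Z : B) (f : hom X Y) (p : path (@hom B) Y Z),
    bracketing (pcons f p).

Section Coherence.
Variable B : Bicategory.
Notation bpath := (path (@hom B)).

(* The composite [((1 ∘ fn) ∘ ...) ∘ f1]: the normal form through which the
   canonical isomorphisms between bracketed composites are defined. *)
Fixpoint path_comp (X Y : B) (p : bpath X Y) : hom X Y :=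
  match p with
  | pnil => one X
  | pcons _ _ f p' => path_comp p' ∘ f
  end.

Fixpoint comp_app (X Y Z : B) (p : bpath X Y) :
    forall q : bpath Y Z, iso2 (path_comp q ∘ path_comp p) (path_comp (papp p q)) :=
  match p with
  | pnil => fun q => iso_runit (path_comp q)
  | pcons _ _ f p' => fun q =>
      iso_cat (iso_whisk (comp_app p' q) (iso_id f))
              (iso_inv (iso_assoc (path_comp q) (path_comp p') f))
  end.

Fixpoint bracketed (X Y : B) (p : bpath X Y) (b : bracketing p) : hom X Y :=
  match b with
  | br_arrow _ _ f => f
  | br_comp _ _ _ _ _ b1 b2 => bracketed b2 ∘ bracketed b1
  end.

Fixpoint normalize (X Y : B) (p : bpath X Y) (b : bracketing p) :
    iso2 (bracketed b) (path_comp p) :=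
  match b with
  | br_arrow _ _ f => iso_inv (iso_lunit f)
  | br_comp _ _ _ p q b1 b2 =>
      iso_cat (comp_app p q) (iso_whisk (normalize b2) (normalize b1))
  end.

Variable ch : choice_of_composites B.

Definition phi (X Y : B) (p : bpath X Y) : hom X Y :=
  match p with
  | pnil => one X
  | pcons _ _ f p' => bracketed (ch f p')
  end.

Definition phi_norm (X Y : B) (p : bpath X Y) : iso2 (phi p) (path_comp p) :=
  match p with
  | pnil => iso_id (one X)
  | pcons _ _ f p' => normalize (ch f p')
  end.

(* By coherence for bicategories this is the only isomorphism between these
   composites which is built from associators and unitors. *)
Definition phi_app (X Y Z : B) (p : bpath X Y) (q : bpath Y Z) :
    iso2 (phi q ∘ phi p) (phi (papp p q)) :=
  iso_cat (iso_inv (phi_norm (papp p q)))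
          (iso_cat (comp_app p q) (iso_whisk (phi_norm q) (phi_norm p))).

Definition path_comp_eq (X Y : B) (p q : bpath X Y) (e : p = q) :
    cell2 (path_comp p) (path_comp q) :=
  match e with eq_refl => id2 _ end.
Definition phi_eq (X Y : B) (p q : bpath X Y) (e : p = q) :
    cell2 (phi p) (phi q) :=
  match e with eq_refl => id2 _ end.

Lemma phi_norm_eq (X Y : B) (p q : bpath X Y) (e : p = q) :
  phi_norm q • phi_eq e = path_comp_eq e • phi_norm p.
Proof. by case: q / e => /=; rewrite vcomp1l vcomp1r. Qed.

Lemma path_comp_eq_cons (X Y Z : B) (f : hom X Y) (p q : bpath Y Z)
    (e : p = q) (e' : pcons f p = pcons f q) :
  path_comp_eq e' = path_comp_eq e ⋆ id2 f.
Proof. by subst q; rewrite (proof_irrelevance _ e' eq_refl) /= hcomp_id. Qed.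

Lemma path_comp_eq_refl (X Y : B) (p : bpath X Y) (e : p = p) :
  path_comp_eq e = id2 _.
Proof. by rewrite (proof_irrelevance _ e eq_refl). Qed.

Lemma comp_app_nil (X Y : B) (p : bpath X Y) :
  path_comp_eq (papp_nil p) • comp_app p (pnil Y) = lunit (path_comp p).
Proof.
elim: p => [X'|X' Y' Z' f p IH] /=.
  by rewrite path_comp_eq_refl vcomp1l lunit_runit_one.
rewrite (path_comp_eq_cons (papp_nil p)) -vcompA -whisk_rr IH -lunit_comp vcompA.
by rewrite assocVK vcomp1r.
Qed.

Lemma comp_appA (X Y Z T : B) (p : bpath X Y) (q : bpath Y Z) (r : bpath Z T) :
  path_comp_eq (pappA p q r) •
    comp_app (papp p q) r • (id2 (path_comp r) ⋆ comp_app p q)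
    • assoc (path_comp r) (path_comp q) (path_comp p)
  = comp_app p (papp q r) • (comp_app q r ⋆ id2 (path_comp p)).
Proof.
elim: p q => [X'|X' Y' Z' f p IH] q /=.
  by rewrite path_comp_eq_refl vcomp1l runit_comp runit_nat.
rewrite (path_comp_eq_cons (pappA p q r)).
set a := path_comp_eq _ in IH *.
have P := pentagon (path_comp r) (path_comp q) (path_comp p) f.
apply: (@iso_epic _ _ _ _ _ _ (iso_assoc _ _ _)) => /=.
rewrite !vcompA -P whisk_ll !vcompA.
have K : (id2 (path_comp r) ⋆ assoc_inv (path_comp q) (path_comp p) f)
   • (id2 (path_comp r) ⋆ assoc (path_comp q) (path_comp p) f) = id2 _.
  by rewrite -whisk_ll assocK hcomp_id.
rewrite -(vcompA (id2 _ ⋆ assoc_inv _ _ _)) K vcomp1l.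
rewrite -(vcompA (id2 _ ⋆ (comp_app p q ⋆ _))) -assoc_nat !vcompA.
rewrite -(vcompA (assoc_inv _ _ _)) assocK vcomp1l -!whisk_rr IH.
rewrite whisk_rr -(hcomp_id (path_comp p) f) -assoc_nat.
by rewrite -(vcompA (assoc_inv _ _ _)) assocK vcomp1l.
Qed.

Lemma phi_app_norm (X Y Z : B) (p : bpath X Y) (q : bpath Y Z) :
  phi_norm (papp p q) • phi_app p q = comp_app p q • (phi_norm q ⋆ phi_norm p).
Proof. by rewrite /phi_app /= fwdKr. Qed.

Lemma phi_app_nil (X Y : B) (p : bpath X Y) :
  phi_eq (papp_nil p) • phi_app p (pnil Y) = lunit (phi p).
Proof.
apply: (@iso_monic _ _ _ _ _ _ (phi_norm p)).
rewrite -vcompA phi_norm_eq vcompA phi_app_norm -vcompA comp_app_nil.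
by rewrite lunit_nat.
Qed.

Lemma phi_nil_app (X Y : B) (p : bpath X Y) :
  fwd (phi_app (pnil X) p) = runit (phi p).
Proof.
apply: (@iso_monic _ _ _ _ _ _ (phi_norm p)).
have -> := phi_app_norm (pnil X) p.
by rewrite /= runit_nat.
Qed.

Lemma phi_appA (X Y Z T : B) (p : bpath X Y) (q : bpath Y Z) (r : bpath Z T) :
  phi_eq (pappA p q r) • phi_app (papp p q) r • (id2 (phi r) ⋆ phi_app p q)
    • assoc (phi r) (phi q) (phi p)
  = phi_app p (papp q r) • (phi_app q r ⋆ id2 (phi p)).
Proof.
have := phi_app_norm q r; have := phi_app_norm p (papp q r).
have := phi_app_norm (papp p q) r; have := phi_app_norm p q.
move: (phi_app p q) (phi_app (papp p q) r) (phi_app p (papp q r)) (phi_app q r).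
move=> i j k l Ei Ej Ek El.
apply: (@iso_monic _ _ _ _ _ _ (phi_norm (papp p (papp q r)))).
rewrite -vcompA phi_norm_eq !vcompA.
rewrite -(vcompA (phi_norm (papp (papp p q) r))) Ej.
rewrite -(vcompA (phi_norm (papp p (papp q r)))) Ek !vcompA.
rewrite -(vcompA (phi_norm r ⋆ _)) -!interchange !vcomp1r Ei El.
rewrite -(vcomp1l (phi_norm r)) interchange -(vcomp1l (phi_norm p)) interchange.
by rewrite !vcomp1l !vcompA -assoc_nat -!vcompA -comp_appA !vcompA.
Qed.

Definition phi_hcomp (X Y Z : B) (p q : bpath X Y) (p' q' : bpath Y Z)
    (b : cell2 (phi p') (phi q')) (a : cell2 (phi p) (phi q)) :
    cell2 (phi (papp p p')) (phi (papp q q')) :=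
  phi_app q q' • (b ⋆ a) • bwd (phi_app p p').

Lemma phi_hcompE (X Y Z : B) (p q : bpath X Y) (p' q' : bpath Y Z)
    (b : cell2 (phi p') (phi q')) (a : cell2 (phi p) (phi q)) :
  phi_hcomp b a • phi_app p p' = phi_app q q' • (b ⋆ a).
Proof. rewrite /phi_hcomp; move: (phi_app p p') (phi_app q q') => i j.
by rewrite !vcompA bwdK vcomp1r. Qed.

Lemma phi_hcompA (X Y Z T : B) (p q : bpath X Y) (p' q' : bpath Y Z)
    (p'' q'' : bpath Z T) (c : cell2 (phi p'') (phi q''))
    (b : cell2 (phi p') (phi q')) (a : cell2 (phi p) (phi q)) :
  phi_eq (pappA q q' q'') • phi_hcomp c (phi_hcomp b a)
  = phi_hcomp (phi_hcomp c b) a • phi_eq (pappA p p' p'').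
Proof.
have := phi_hcompE c (phi_hcomp b a); have := phi_hcompE (phi_hcomp c b) a.
have := phi_hcompE b a; have := phi_hcompE c b.
have := phi_appA p p' p''; have := phi_appA q q' q''.
move: (phi_hcomp c (phi_hcomp b a)) (phi_hcomp (phi_hcomp c b) a).
move: (phi_hcomp c b) (phi_hcomp b a) => cb ba c_ba cb_a.
move: (phi_app (papp p p') p'') (phi_app (papp q q') q'').
move: (phi_app p (papp p' p'')) (phi_app q (papp q' q'')).
move: (phi_app p p') (phi_app q q') (phi_app p' p'') (phi_app q' q'').
move=> i i' j j' k k' l l' Eq Ep Ecb Eba Ecb_a Ec_ba.
apply: (@iso_epic _ _ _ _ _ _
  (iso_cat l (iso_cat (iso_whisk (iso_id _) i) (iso_assoc _ _ _)))) => /=.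
rewrite !vcompA Ep -(vcompA cb_a) Ecb_a.
rewrite -(vcompA c_ba) Ec_ba !vcompA -interchange vcomp1r Ecb.
rewrite -(vcompA (c ⋆ _)) -interchange Eba vcomp1r.
rewrite -{1}(vcomp1l c) interchange !vcompA -assoc_nat.
by rewrite -{2}(vcomp1l a) interchange -!vcompA -Eq !vcompA.
Qed.

Lemma phi_hcomp_nil (X Y : B) (p q : bpath X Y) (a : cell2 (phi p) (phi q)) :
  phi_eq (papp_nil q) • phi_hcomp (id2 (phi (pnil Y))) a
  = a • phi_eq (papp_nil p).
Proof.
have := phi_hcompE (id2 (phi (pnil Y))) a.
have := phi_app_nil p; have := phi_app_nil q; move: (phi_hcomp _ _).
move: (phi_app p (pnil Y)) (phi_app q (pnil Y)) => i j c Eq Ep Ec.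
apply: (@iso_epic _ _ _ _ _ _ i).
by rewrite !vcompA Ec Ep -vcompA Eq lunit_nat.
Qed.

Lemma phi_nil_hcomp (X Y : B) (p q : bpath X Y) (a : cell2 (phi p) (phi q)) :
  phi_hcomp a (id2 (phi (pnil X))) = a.
Proof.
apply: (@iso_epic _ _ _ _ _ _ (phi_app (pnil X) p)).
by rewrite phi_hcompE !phi_nil_app runit_nat.
Qed.

Lemma phi_hcomp_id (X Y Z : B) (p : bpath X Y) (p' : bpath Y Z) :
  phi_hcomp (id2 (phi p')) (id2 (phi p)) = id2 _.
Proof. have := phi_hcompE (id2 (phi p')) (id2 (phi p)); move: (phi_hcomp _ _).
move: (phi_app p p') => i c E; apply: (@iso_epic _ _ _ _ _ _ i).
by rewrite E hcomp_id vcomp1l vcomp1r.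
Qed.

Lemma phi_interchange (X Y Z : B) (p q r : bpath X Y) (p' q' r' : bpath Y Z)
    (b' : cell2 (phi q') (phi r')) (a' : cell2 (phi q) (phi r))
    (b : cell2 (phi p') (phi q')) (a : cell2 (phi p) (phi q)) :
  phi_hcomp b' a' • phi_hcomp b a = phi_hcomp (b' • b) (a' • a).
Proof.
have := phi_hcompE (b' • b) (a' • a).
have := phi_hcompE b' a'; have := phi_hcompE b a.
move: (phi_hcomp _ _) (phi_hcomp _ _) (phi_hcomp _ _) => c d e.
move: (phi_app p p') (phi_app q q') (phi_app r r') => i j k Ec Ed Ee.
apply: (@iso_epic _ _ _ _ _ _ i).
by rewrite vcompA Ec -vcompA Ed Ee vcompA interchange.
Qed.

End Coherence.

Fixpoint right_bracketing (T : Type) (H : T -> T -> Type) (A B C : T)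
    (f : H A B) (p : path H B C) : bracketing (pcons f p) :=
  match p as p0 in path _ _ C0 return forall f0, bracketing (pcons f0 p0) with
  | pnil => fun f0 => br_arrow f0
  | pcons _ _ g p' => fun f0 => br_comp (br_arrow f0) (right_bracketing g p')
  end f.

Lemma choice_of_composites_inhabited (B : Bicategory) :
  inhabited (choice_of_composites B).
Proof. by constructor=> X Y Z f p; apply: right_bracketing. Qed.

Lemma square_inj (O : Type) (hor ver : O -> O -> Type)
    (dcell : forall A B A' B', hor A B -> ver A A' -> ver B B' -> hor A' B' -> Type)
    (A B A' B' : O) (f : hor A B) (v : ver A A') (w : ver B B') (g : hor A' B')
    (a b : dcell A B A' B' f v w g) :
  Square dcell a = Square dcell b -> a = b.
Proof. by case=> E; do 4 have {}E := inj_pair2 _ _ _ _ _ E. Qed.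

Section Dbl.
Variable B : Bicategory.
Notation bpath := (path (@hom B)).

(* A path with a marked object, cut there: [before] consists of f_1, ..., f_{i0}
   and [after] of f_{i0+1}, ..., f_n. *)
Record marked_path := MarkedPath {
  src : B; mark : B; tgt : B;
  before : bpath src mark;
  after : bpath mark tgt }.

(* The doubly marked paths with domain [x] and codomain [y]: [x] and [y] are the
   paths obtained from [before x], [mid], [after y] by marking either end of the
   segment [mid] = f_{i0+1}, ..., f_{i1}. *)
Record doubly_marked (x y : marked_path) := DoublyMarked {
  mid : bpath (mark x) (mark y);
  mid_before : existT (fun X => bpath X (mark y)) (src y) (before y)
             = existT _ (src x) (papp (before x) mid);
  mid_after : existT (fun Y => bpath (mark x) Y) (tgt x) (after x)
            = existT _ (tgt y) (papp mid (after y)) }.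

Lemma doubly_marked_ext (x y : marked_path) (f g : doubly_marked x y) :
  mid f = mid g -> f = g.
Proof.
case: f g => [p e1 e2] [q e3 e4] /= E; subst q.
by rewrite (proof_irrelevance _ e1 e3) (proof_irrelevance _ e2 e4).
Qed.

Definition dm_id (x : marked_path) : doubly_marked x x.
Proof. by exists (pnil (mark x)); rewrite ?papp_nil. Defined.

Definition dm_comp (x y z : marked_path) (g : doubly_marked y z)
    (f : doubly_marked x y) : doubly_marked x z.
Proof.
exists (papp (mid f) (mid g)).
- rewrite -pappA (mid_before g).
  exact: (f_equal (fun s : {X : B & bpath X (mark y)} =>
    existT _ (projT1 s) (papp (projT2 s) (mid g))) (mid_before f)).
- rewrite pappA (mid_after f).
  exact: (f_equal (fun s : {Y : B & bpath (mark y) Y} =>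
    existT _ (projT1 s) (papp (mid f) (projT2 s))) (mid_after g)).
Defined.

(* Any three consecutive paths form a doubly marked path, and all doubly marked
   paths are of this form. *)
Definition dm_of (X A C Y : B) (p : bpath X A) (q : bpath A C) (r : bpath C Y) :
  doubly_marked (MarkedPath p (papp q r)) (MarkedPath (papp p q) r) :=
  @DoublyMarked (MarkedPath p (papp q r)) (MarkedPath (papp p q) r) q
    eq_refl eq_refl.

Lemma dm_ofP (x y : marked_path) (f : doubly_marked x y) :
  exists (X A C Y : B) (p : bpath X A) (q : bpath A C) (r : bpath C Y),
    existT (fun xy => doubly_marked (fst xy) (snd xy)) (x, y) f
    = existT _ (_, _) (dm_of p q r).
Proof.
case: x y f => [X A Y p r'] [X' C Y' p' r] [q /= e1 e2].
have E1 := f_equal (@projT1 _ _) e1; have E2 := f_equal (@projT1 _ _) e2.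
simpl in E1, E2; subst X' Y.
have E1 := inj_pair2 _ _ _ _ _ e1; have E2 := inj_pair2 _ _ _ _ _ e2.
rewrite {}E1 {}E2 in e1 e2 *; exists X, A, C, Y', p, q, r.
by rewrite (proof_irrelevance _ e1 eq_refl) (proof_irrelevance _ e2 eq_refl).
Qed.

Variable ch : choice_of_composites B.
Notation phi := (phi ch).

Definition hom_cast (A A' C C' : B) (v : A = A') (w : C = C') (f : hom A C) :
    hom A' C' :=
  match v in _ = X, w in _ = Y return hom X Y with
  | eq_refl, eq_refl => f
  end.

(* The vertical boundaries [v], [w] only record equalities of marked objects. *)
Definition phi_cell (A C A' C' : B) (p : bpath A C) (v : A = A') (w : C = C')
    (q : bpath A' C') : Type :=
  cell2 (hom_cast v w (phi p)) (phi q).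

Definition pc_hid (A A' : B) (v : A = A') : phi_cell (pnil A) v v (pnil A').
Proof. destruct v; exact (id2 (phi (pnil A))). Defined.

Definition pc_vid (A C : B) (p : bpath A C) : phi_cell p eq_refl eq_refl p :=
  id2 (phi p).

Definition pc_vcomp (A C A' C' A'' C'' : B) (p : bpath A C) (q : bpath A' C')
    (r : bpath A'' C'') (v : A = A') (w : C = C') (v' : A' = A'') (w' : C' = C'')
    (b : phi_cell q v' w' r) (a : phi_cell p v w q) :
    phi_cell p (eq_trans v v') (eq_trans w w') r.
Proof. destruct v', w'; exact (b • a). Defined.

Definition pc_hcomp (A C E A' C' E' : B) (p : bpath A C) (p' : bpath C E)
    (u : A = A') (v : C = C') (w : E = E') (q : bpath A' C') (q' : bpath C' E')
    (b : phi_cell p' v w q') (a : phi_cell p u v q) :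
    phi_cell (papp p p') u w (papp q q').
Proof. destruct u, v, w; exact (phi_hcomp b a). Defined.

Lemma phi_cell_eq (A C : B) (p p' q q' : bpath A C) (e : p = p') (e' : q = q')
    (a : phi_cell p eq_refl eq_refl q) (b : phi_cell p' eq_refl eq_refl q') :
  phi_eq ch e' • a = b • phi_eq ch e -> Square phi_cell a = Square phi_cell b.
Proof. by subst p' q'; rewrite /= vcomp1l vcomp1r => ->. Qed.

Lemma pc_vcompA (A C A' C' A'' C'' A3 C3 : B) (p : bpath A C) (q : bpath A' C')
    (r : bpath A'' C'') (s : bpath A3 C3) (v : A = A') (w : C = C')
    (v' : A' = A'') (w' : C' = C'') (v'' : A'' = A3) (w'' : C'' = C3)
    (c : phi_cell r v'' w'' s) (b : phi_cell q v' w' r) (a : phi_cell p v w q) :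
  Square phi_cell (pc_vcomp (pc_vcomp c b) a)
  = Square phi_cell (pc_vcomp c (pc_vcomp b a)).
Proof. by subst A3 C3 A'' C'' A' C'; rewrite /= vcompA. Qed.

Lemma pc_vcomp1l (A C A' C' : B) (p : bpath A C) (q : bpath A' C')
    (v : A = A') (w : C = C') (a : phi_cell p v w q) :
  Square phi_cell (pc_vcomp (pc_vid q) a) = Square phi_cell a.
Proof. by subst A' C'; rewrite /= vcomp1l. Qed.

Lemma pc_vcomp1r (A C A' C' : B) (p : bpath A C) (q : bpath A' C')
    (v : A = A') (w : C = C') (a : phi_cell p v w q) :
  Square phi_cell (pc_vcomp a (pc_vid p)) = Square phi_cell a.
Proof. by subst A' C'; rewrite /= vcomp1r. Qed.

Lemma pc_hcompA (A C D E A' C' D' E' : B)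
    (p : bpath A C) (q : bpath C D) (r : bpath D E)
    (u : A = A') (v : C = C') (w : D = D') (x : E = E')
    (p' : bpath A' C') (q' : bpath C' D') (r' : bpath D' E')
    (c : phi_cell r w x r') (b : phi_cell q v w q') (a : phi_cell p u v p') :
  Square phi_cell (pc_hcomp (pc_hcomp c b) a)
  = Square phi_cell (pc_hcomp c (pc_hcomp b a)).
Proof.
subst A' C' D' E'; symmetry.
by apply: (@phi_cell_eq _ _ _ _ _ _ (pappA p q r) (pappA p' q' r')); apply: phi_hcompA.
Qed.

Lemma pc_hcomp1l (A C A' C' : B) (p : bpath A C) (q : bpath A' C')
    (v : A = A') (w : C = C') (a : phi_cell p v w q) :
  Square phi_cell (pc_hcomp (pc_hid w) a) = Square phi_cell a.
Proof.
subst A' C'.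
by apply: (@phi_cell_eq _ _ _ _ _ _ (papp_nil p) (papp_nil q)); apply: phi_hcomp_nil.
Qed.

Lemma pc_hcomp1r (A C A' C' : B) (p : bpath A C) (q : bpath A' C')
    (v : A = A') (w : C = C') (a : phi_cell p v w q) :
  Square phi_cell (pc_hcomp a (pc_hid v)) = Square phi_cell a.
Proof.
by subst A' C'; congr Square; apply: phi_nil_hcomp.
Qed.

Lemma pc_interchange (A C E A' C' E' A'' C'' E'' : B)
    (p : bpath A C) (p' : bpath C E) (q : bpath A' C') (q' : bpath C' E')
    (r : bpath A'' C'') (r' : bpath C'' E'')
    (u : A = A') (v : C = C') (w : E = E')
    (u' : A' = A'') (v' : C' = C'') (w' : E' = E'')
    (b' : phi_cell q' v' w' r') (a' : phi_cell q u' v' r)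
    (b : phi_cell p' v w q') (a : phi_cell p u v q) :
  pc_vcomp (pc_hcomp b' a') (pc_hcomp b a)
  = pc_hcomp (pc_vcomp b' b) (pc_vcomp a' a).
Proof. by subst A'' C'' E'' A' C' E'; apply: phi_interchange. Qed.

Lemma pc_hid_vcomp (A A' A'' : B) (v : A = A') (v' : A' = A'') :
  pc_hid (eq_trans v v') = pc_vcomp (pc_hid v') (pc_hid v).
Proof. by subst A'' A'; rewrite /= vcomp1l. Qed.

Lemma pc_vid_hcomp (A C E : B) (p : bpath A C) (q : bpath C E) :
  pc_vid (papp p q) = pc_hcomp (pc_vid q) (pc_vid p).
Proof. by symmetry; apply: phi_hcomp_id. Qed.

Definition dbl_cell (x y x' y' : marked_path) (f : doubly_marked x y)
    (v : mark x = mark x') (w : mark y = mark y') (g : doubly_marked x' y') : Type :=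
  phi_cell (mid f) v w (mid g).

Lemma dbl_cell_eq (x y x' y' : marked_path) (f f' : doubly_marked x y)
    (v v' : mark x = mark x') (w w' : mark y = mark y')
    (g g' : doubly_marked x' y') (a : dbl_cell f v w g) (b : dbl_cell f' v' w' g') :
  Square phi_cell a = Square phi_cell b -> Square dbl_cell a = Square dbl_cell b.
Proof.
move=> E.
have Ef := doubly_marked_ext (f_equal (fun s => top s) E : mid f = mid f').
have Eg := doubly_marked_ext (f_equal (fun s => bottom s) E : mid g = mid g').
subst f' g'; move: (proof_irrelevance _ v v') (proof_irrelevance _ w w') => Ev Ew.
by subst v' w'; rewrite (square_inj E).
Qed.

Definition Dbl : DoubleCategory.
Proof.
refine {|
  dob := marked_path;
  hor := doubly_marked;
  ver := fun x y => mark x = mark y;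
  dcell := dbl_cell;
  hid := dm_id;
  hcmp := dm_comp;
  vid := fun x => eq_refl;
  vcmp := fun x y z w v => eq_trans v w;
  cell_hid := fun x x' v => pc_hid v;
  cell_vid := fun x y f => pc_vid (mid f);
  cell_hcmp := fun x y z x' y' z' f g u v w f' g' b a => pc_hcomp b a;
  cell_vcmp := fun x y x' y' x'' y'' f g h v w v' w' b a => pc_vcomp b a |}.
- by move=> *; apply: doubly_marked_ext; rewrite /= pappA.
- by move=> *; apply: doubly_marked_ext; rewrite /= papp_nil.
- by move=> *; apply: doubly_marked_ext.
- by move=> *; apply: proof_irrelevance.
- by move=> *; apply: proof_irrelevance.
- by move=> *; apply: proof_irrelevance.
- by move=> *; apply: dbl_cell_eq; apply: pc_vcompA.
- by move=> *; apply: dbl_cell_eq; apply: pc_vcomp1l.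
- by move=> *; apply: dbl_cell_eq; apply: pc_vcomp1r.
- by move=> *; apply: dbl_cell_eq; apply: pc_hcompA.
- by move=> *; apply: dbl_cell_eq; apply: pc_hcomp1l.
- by move=> *; apply: dbl_cell_eq; apply: pc_hcomp1r.
- by move=> *; apply: pc_interchange.
- by move=> *; apply: pc_hid_vcomp.
- by move=> *; apply: pc_vid_hcomp.
- by [].
Defined.

End Dbl.

Section DblF.
Variables (B D : Bicategory) (F : Homomorphism B D).
Notation bpath := (path (@hom B)).
Notation Fpath := (pmap (@F1 B D F)).

Definition F_iso (X Y : B) (f g : hom X Y) (i : iso2 f g) : iso2 (F1 F f) (F1 F g).
Proof.
by exists (F2 F i) (F2 F (bwd i)); rewrite -F2_vcomp ?bwdK ?fwdK F2_id.
Defined.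

Fixpoint F_path_comp (X Y : B) (p : bpath X Y) :
    iso2 (path_comp (Fpath p)) (F1 F (path_comp p)) :=
  match p with
  | pnil => Fone F X
  | pcons _ _ f p' =>
      iso_cat (Fcomp F (path_comp p') f)
              (iso_whisk (F_path_comp p') (iso_id (F1 F f)))
  end.

Lemma F_comp_app (X Y Z : B) (p : bpath X Y) (q : bpath Y Z) :
  F_path_comp (papp p q) • path_comp_eq (pmap_app (@F1 B D F) p q)
    • comp_app (Fpath p) (Fpath q)
  = F2 F (comp_app p q) • Fcomp F (path_comp q) (path_comp p)
    • (F_path_comp q ⋆ F_path_comp p).
Proof.
elim: p q => [X'|X' Y' Z' f p IH] q /=.
  rewrite path_comp_eq_refl vcomp1l -runit_nat -Frunit !vcompA.
  by rewrite whisk_rl.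
rewrite (path_comp_eq_cons (pmap_app (@F1 B D F) p q)).
have {}IH := IH q; set e := path_comp_eq _ in IH *; move: e IH => e IH.
move: (F_path_comp (papp p q)) (comp_app (Fpath p) (Fpath q)) IH => s c IH.
rewrite !vcompA -(vcompA (e ⋆ _)) -whisk_rr -(vcompA (s ⋆ _)) -whisk_rr IH.
rewrite F2_vcomp !vcompA.
apply: (@iso_epic _ _ _ _ _ _ (iso_assoc _ _ _)) => /=.
rewrite !vcompA assocK vcomp1r !whisk_rr.
rewrite -{2}(vcomp1l (F_path_comp q)) interchange !vcompA -assoc_nat.
have A := Fassoc F (path_comp q) (path_comp p) f.
rewrite -(vcompA (id2 _ ⋆ _)) -(vcompA (Fcomp F _ (_ ∘ _))) -A !vcompA.
rewrite -(vcompA (F2 F (assoc_inv _ _ _))) -F2_vcomp assocK F2_id vcomp1l.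
rewrite -!vcompA; do 2 congr (_ • _).
by rewrite -(F2_id F f) Fcomp_nat.
Qed.

Variables (chB : choice_of_composites B) (chD : choice_of_composites D).

(* The comparison between the chosen composite of the images and the image of the
   chosen composite. *)
Definition F_phi (X Y : B) (p : bpath X Y) :
    iso2 (phi chD (Fpath p)) (F1 F (phi chB p)) :=
  iso_cat (F_iso (iso_inv (phi_norm chB p)))
          (iso_cat (F_path_comp p) (phi_norm chD (Fpath p))).

Lemma F_phi_norm (X Y : B) (p : bpath X Y) :
  F2 F (phi_norm chB p) • F_phi p = F_path_comp p • phi_norm chD (Fpath p).
Proof. by rewrite /F_phi /= -vcompA -F2_vcomp fwdK F2_id vcomp1l. Qed.

Lemma F_phi_nil (X : B) : fwd (F_phi (pnil X)) = Fone F X.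
Proof. by rewrite /F_phi /= F2_id vcomp1l vcomp1r. Qed.

Lemma F_phi_app (X Y Z : B) (p : bpath X Y) (q : bpath Y Z) :
  F_phi (papp p q) • phi_eq chD (pmap_app (@F1 B D F) p q)
    • phi_app chD (Fpath p) (Fpath q)
  = F2 F (phi_app chB p q) • Fcomp F (phi chB q) (phi chB p) • (F_phi q ⋆ F_phi p).
Proof.
have := F_phi_norm (papp p q); have := F_phi_norm p; have := F_phi_norm q.
have := phi_app_norm chB p q; have := phi_app_norm chD (Fpath p) (Fpath q).
move: (phi_app chB p q) (phi_app chD _ _) (F_phi (papp p q)).
move: (F_phi p) (F_phi q) => i j k l m El Ek Ej Ei Em.
apply: (@iso_monic _ _ _ _ _ _ (F_iso (phi_norm chB (papp p q)))) => /=.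
rewrite -vcompA Em !vcompA -(vcompA (phi_norm chD _)) phi_norm_eq !vcompA El.
rewrite -!vcompA -F2_vcomp Ek F2_vcomp !vcompA.
rewrite -(vcompA (F2 F (_ ⋆ _))) -Fcomp_nat !vcompA -interchange Ej Ei.
rewrite interchange -!vcompA; congr (_ • _).
by rewrite !vcompA F_comp_app.
Qed.

Definition F_cell (X Y : B) (p q : bpath X Y) (a : cell2 (phi chB p) (phi chB q)) :
    cell2 (phi chD (Fpath p)) (phi chD (Fpath q)) :=
  bwd (F_phi q) • F2 F a • F_phi p.

Lemma F_cellE (X Y : B) (p q : bpath X Y) (a : cell2 (phi chB p) (phi chB q)) :
  F_phi q • F_cell a = F2 F a • F_phi p.
Proof. by rewrite /F_cell fwdKr. Qed.

Lemma F_cell_id (X Y : B) (p : bpath X Y) : F_cell (id2 (phi chB p)) = id2 _.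
Proof. by rewrite /F_cell F2_id vcomp1l bwdK. Qed.

Lemma F_cell_vcomp (X Y : B) (p q r : bpath X Y)
    (b : cell2 (phi chB q) (phi chB r)) (a : cell2 (phi chB p) (phi chB q)) :
  F_cell (b • a) = F_cell b • F_cell a.
Proof.
have := F_cellE (b • a); have := F_cellE b; have := F_cellE a.
move: (F_cell _) (F_cell _) (F_cell _) => c d e.
move: (F_phi p) (F_phi q) (F_phi r) => i j k Ec Ed Ee.
apply: (@iso_monic _ _ _ _ _ _ k).
by rewrite Ee -vcompA Ed vcompA Ec F2_vcomp vcompA.
Qed.

Lemma F_cell_hcomp (X Y Z : B) (p q : bpath X Y) (p' q' : bpath Y Z)
    (b : cell2 (phi chB p') (phi chB q')) (a : cell2 (phi chB p) (phi chB q)) :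
  phi_eq chD (pmap_app (@F1 B D F) q q') • phi_hcomp (F_cell b) (F_cell a)
  = F_cell (phi_hcomp b a) • phi_eq chD (pmap_app (@F1 B D F) p p').
Proof.
have := phi_hcompE (F_cell b) (F_cell a); have := phi_hcompE b a.
have := F_cellE (phi_hcomp b a); have := F_cellE b; have := F_cellE a.
have := F_phi_app p p'; have := F_phi_app q q'.
move: (F_cell (phi_hcomp b a)) (phi_hcomp (F_cell b) (F_cell a)).
move: (F_cell b) (F_cell a) (phi_hcomp b a) => Fb Fa ba Fba FbFa.
move: (phi_app chB p p') (phi_app chB q q') (phi_app chD _ _) (phi_app chD _ _).
move: (F_phi p) (F_phi q) (F_phi p') (F_phi q') (F_phi (papp p p'))
  (F_phi (papp q q')) => i j i' j' k l m n x y Eq Ep Ea Eb Eba E EF.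
apply: (@iso_monic _ _ _ _ _ _ l); apply: (@iso_epic _ _ _ _ _ _ x).
rewrite !vcompA EF -(vcompA l Fba) Eba vcompA Ep -(vcompA _ y) -(vcompA l) Eq.
rewrite vcompA vcompA -interchange Ea Eb interchange -!vcompA -F2_vcomp E F2_vcomp.
by rewrite !vcompA -(vcompA (F2 F (b ⋆ a))) -Fcomp_nat !vcompA.
Qed.

Definition pc_map (A C A' C' : B) (p : bpath A C) (v : A = A') (w : C = C')
    (q : bpath A' C') (a : phi_cell chB p v w q) :
    phi_cell chD (Fpath p) (f_equal F v) (f_equal F w) (Fpath q).
Proof. destruct v, w; exact (F_cell a). Defined.

Lemma pc_map_hid (A A' : B) (v : A = A') :
  Square (phi_cell chD) (pc_map (pc_hid chB v))
  = Square (phi_cell chD) (pc_hid chD (f_equal F v)).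
Proof. by subst A'; congr Square; apply: (F_cell_id (pnil A)). Qed.

Lemma pc_map_hcomp (A C E A' C' E' : B) (p : bpath A C) (p' : bpath C E)
    (u : A = A') (v : C = C') (w : E = E') (q : bpath A' C') (q' : bpath C' E')
    (b : phi_cell chB p' v w q') (a : phi_cell chB p u v q) :
  Square (phi_cell chD) (pc_map (pc_hcomp b a))
  = Square (phi_cell chD) (pc_hcomp (pc_map b) (pc_map a)).
Proof.
subst A' C' E'; symmetry.
apply: (@phi_cell_eq _ _ _ _ _ _ _ _
  (pmap_app (@F1 B D F) p p') (pmap_app (@F1 B D F) q q')).
exact: F_cell_hcomp.
Qed.

Lemma pc_map_vcomp (A C A' C' A'' C'' : B) (p : bpath A C) (q : bpath A' C')
    (r : bpath A'' C'') (v : A = A') (w : C = C') (v' : A' = A'') (w' : C' = C'')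
    (b : phi_cell chB q v' w' r) (a : phi_cell chB p v w q) :
  Square (phi_cell chD) (pc_map (pc_vcomp b a))
  = Square (phi_cell chD) (pc_vcomp (pc_map b) (pc_map a)).
Proof. by subst A'' C'' A' C'; congr Square; apply: F_cell_vcomp. Qed.

Definition mp_map (x : marked_path B) : marked_path D :=
  MarkedPath (Fpath (before x)) (Fpath (after x)).

Definition dm_map (x y : marked_path B) (f : doubly_marked x y) :
  doubly_marked (mp_map x) (mp_map y).
Proof.
exists (Fpath (mid f)).
- rewrite /= pmap_app.
  exact: (f_equal (fun s : {X : B & bpath X (mark y)} =>
    existT (fun X => path (@hom D) X (F (mark y))) (F (projT1 s)) (Fpath (projT2 s)))
    (mid_before f)).
- rewrite /= pmap_app.
  exact: (f_equal (fun s : {Y : B & bpath (mark x) Y} =>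
    existT (fun Y => path (@hom D) (F (mark x)) Y) (F (projT1 s)) (Fpath (projT2 s)))
    (mid_after f)).
Defined.

Definition DblF : DoubleFunctor (Dbl chB) (Dbl chD).
Proof.
refine {|
  D0 := mp_map : Dbl chB -> Dbl chD;
  Dh := dm_map;
  Dv := fun x y (v : mark x = mark y) => f_equal F v;
  Dc := fun x y x' y' f v w g a => pc_map a |}.
- by move=> *; apply: doubly_marked_ext.
- by move=> *; apply: doubly_marked_ext; rewrite /= pmap_app.
- by [].
- by move=> x y z w v; exact: (proof_irrelevance (F (mark x) = F (mark z))).
- by move=> *; apply: dbl_cell_eq; apply: pc_map_hid.
- by move=> *; apply: dbl_cell_eq; congr Square; apply: F_cell_id.
- by move=> *; apply: dbl_cell_eq; apply: pc_map_hcomp.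
- by move=> *; apply: dbl_cell_eq; apply: pc_map_vcomp.
Defined.

End DblF.

(* In [C] all bracketings of a path have the same composite, and [path_comp] only
   adds an identity. *)
Definition W_doubly_marked (C : Category) (W : arrow_class C)
    (x y : marked_path (locally_discrete C)) (f : doubly_marked x y) : Prop :=
  W (mark x) (mark y) (path_comp (mid f)).

(* Main.v *)
Require Import Defs.
From Stdlib Require Import ssreflect ProofIrrelevance.

(* Vertical arrows of [Dbl] only record equalities of marked objects, so a companion
   in [Dbl] is a path whose composite is isomorphic to an identity: the cells [psi]
   and [chi] are mutually inverse, since [chi ∘ psi] is [psi • chi] by
   Eckmann-Hilton.  A left (right) precompanion is then a path whose composite has
   a left (right) inverse up to isomorphism: an arrow with such an inverse can be
   adjoined to the path, since [Dbl] allows arbitrary extensions of paths. *)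

Set Implicit Arguments.
Unset Strict Implicit.
Unset Printing Implicit Defensive.

Section Inverses.
Variable B : Bicategory.

Definition has_left_inverse (X Y : B) (f : hom X Y) : Prop :=
  exists g : hom Y X, inhabited (iso2 (g ∘ f) (one X)).

Definition has_right_inverse (X Y : B) (f : hom X Y) : Prop :=
  exists g : hom Y X, inhabited (iso2 (f ∘ g) (one Y)).

Lemma left_inverse_iso (X Y : B) (f g : hom X Y) :
  iso2 f g -> has_left_inverse g -> has_left_inverse f.
Proof.
move=> i [h [j]]; exists h; constructor.
exact: (iso_cat j (iso_whisk (iso_id h) i)).
Qed.

Lemma right_inverse_iso (X Y : B) (f g : hom X Y) :
  iso2 f g -> has_right_inverse g -> has_right_inverse f.
Proof.
move=> i [h [j]]; exists h; constructor.
exact: (iso_cat j (iso_whisk i (iso_id h))).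
Qed.

(** A left inverse [r] and a right inverse [s] agree up to isomorphism: [s] ≅ [(r ∘ f) ∘ s] ≅
    [r ∘ (f ∘ s)] ≅ [r]. So [r] is inverse on both sides. *)
Lemma internal_equivalenceP (X Y : B) (f : hom X Y) :
  internal_equivalence f <-> has_left_inverse f /\ has_right_inverse f.
Proof.
split=> [[g [i j]]|[[r [i]] [s [j]]]]; first by split; exists g.
have k : iso2 s r.
  apply: (iso_cat (iso_runit r)); apply: (iso_cat (iso_whisk (iso_id r) j)).
  apply: (iso_cat (iso_assoc r f s)).
  exact: (iso_cat (iso_whisk (iso_inv i) (iso_id s)) (iso_inv (iso_lunit s))).
exists r; split; constructor=> //.
exact: (iso_cat j (iso_whisk (iso_id f) (iso_inv k))).
Qed.

Lemma internal_equivalence_iso (X Y : B) (f g : hom X Y) :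
  iso2 f g -> internal_equivalence g -> internal_equivalence f.
Proof.
move=> i /internal_equivalenceP[l r]; apply/internal_equivalenceP.
by split; [apply: left_inverse_iso l | apply: right_inverse_iso r].
Qed.

End Inverses.

Section DblPrecompanions.
Variables (B : Bicategory) (ch : choice_of_composites B).
Notation bpath := (path (@hom B)).
Notation phi := (phi ch).
Notation phi_cell := (phi_cell ch).

(** Passing through the normal form [one Y ∘ f] avoids an inversion of the dependent type
    [bracketing]. *)
Definition phi_arrow (X Y : B) (f : hom X Y) : iso2 (phi (pcons f (pnil Y))) f :=
  iso_cat (iso_lunit f) (phi_norm ch (pcons f (pnil Y))).

(** This is the Eckmann-Hilton argument: split [chi ⋆ psi] into two whiskerings, move each through a
    unitor by naturality, and use that both unitors agree on [one A]. *)
Lemma phi_hcomp_loop (A : B) (p : bpath A A)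
    (psi : cell2 (phi (pnil A)) (phi p)) (chi : cell2 (phi p) (phi (pnil A))) :
  phi_eq ch (papp_nil p) • phi_hcomp chi psi = psi • chi.
Proof.
have := phi_hcompE chi psi; have := phi_app_nil ch p.
have := phi_nil_app ch p; move: (phi_hcomp _ _) => c.
move: (phi_app ch (pnil A) p) (phi_app ch p (pnil A)) => /= i j Ei Ej Ec.
apply: (@iso_epic _ _ _ _ _ _ i).
rewrite vcompA Ec -vcompA Ej Ei -(whisk_rl chi psi) -vcompA lunit_nat.
by rewrite !vcompA lunit_runit_one runit_nat.
Qed.

(** The endpoints are variables here, not marks of paths, so that [v] can be eliminated. *)
Lemma companion_cells_iso (A C : B) (p : bpath A C) (v : A = C)
    (psi : phi_cell (pnil A) eq_refl v p) (chi : phi_cell p v eq_refl (pnil C)) :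
  Square phi_cell (pc_hcomp chi psi) = Square phi_cell (pc_vid ch p) ->
  Square phi_cell (pc_vcomp chi psi) = Square phi_cell (pc_hid ch v) ->
  inhabited (iso2 (hom_cast eq_refl v (one A)) (phi p)).
Proof.
subst C; move=> Eh Ev0; have Ev := square_inj Ev0.
constructor; exists (psi : cell2 _ _) chi => //.
rewrite -phi_hcomp_loop.
have := @square_inj _ _ _ phi_cell A A A A p eq_refl eq_refl p; apply.
rewrite -[RHS]Eh; symmetry.
apply: (@phi_cell_eq _ _ _ _ _ _ _ _ eq_refl (papp_nil p)).
by rewrite vcomp1r.
Qed.

Lemma square_mid (x y x' y' : marked_path B) (f f' : doubly_marked x y)
    (v v' : mark x = mark x') (w w' : mark y = mark y')
    (g g' : doubly_marked x' y') (a : dbl_cell ch f v w g) (b : dbl_cell ch f' v' w' g') :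
  Square (dbl_cell ch) a = Square (dbl_cell ch) b ->
  Square phi_cell a = Square phi_cell b.
Proof.
exact: (f_equal (fun s : square_of (dbl_cell ch) x y x' y' =>
  Square phi_cell (inner s : phi_cell _ _ _ _))).
Qed.

Lemma companion_iso (x y : Dbl ch) (f : hor x y) :
  is_companion f -> exists v : mark x = mark y,
    inhabited (iso2 (hom_cast eq_refl v (one (mark x))) (phi (mid f))).
Proof.
move=> [v [psi [chi [/square_mid Eh /square_mid Ev]]]]; exists v.
exact: companion_cells_iso Eh Ev.
Qed.

Lemma iso_one_companion (X Y X' Y' A : B) (p : bpath X A) (q : bpath A Y)
    (p' : bpath X' A) (q' : bpath A Y')
    (f : @hor (Dbl ch) (MarkedPath p q) (MarkedPath p' q')) :
  iso2 (phi (mid f)) (one A) -> is_companion f.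
Proof.
(* Both marks are literally [A], so the vertical companion is [eq_refl], and the isomorphism and its
   inverse serve as [chi] and [psi]. *)
move=> i; exists eq_refl, (bwd i), (fwd i); split; last first.
  by apply: dbl_cell_eq; congr Square; apply: fwdK.
apply: dbl_cell_eq; apply: (@phi_cell_eq _ _ _ _ _ _ _ _ eq_refl (papp_nil (mid f))).
by rewrite phi_hcomp_loop bwdK vcomp1r.
Qed.

Lemma inverse_cells_iso (A C A' C' : B) (p : bpath A C) (q : bpath A' C')
    (v : A = A') (w : C = C') (v' : A' = A) (w' : C' = C)
    (a : phi_cell p v w q) (b : phi_cell q v' w' p) :
  Square phi_cell (pc_vcomp b a) = Square phi_cell (pc_vid ch p) ->
  Square phi_cell (pc_vcomp a b) = Square phi_cell (pc_vid ch q) ->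
  inhabited (iso2 (hom_cast v w (phi p)) (phi q)).
Proof.
(* Once the endpoints are identified, [v'] and [w'] are loops, and proof irrelevance makes them
   trivial. *)
subst A' C'; rewrite (proof_irrelevance _ v' eq_refl) in b *.
rewrite (proof_irrelevance _ w' eq_refl) in b *.
by move=> E1 E2; constructor; exists a b; [apply: (square_inj E1) | apply: (square_inj E2)].
Qed.

Lemma vertically_invertible_iso (x y x' y' : Dbl ch) (f : hor x y)
    (v : ver x x') (w : ver y y') (g : hor x' y') (a : dcell f v w g) :
  vertically_invertible a -> inhabited (iso2 (hom_cast v w (phi (mid f))) (phi (mid g))).
Proof.
move=> [v' [w' [b [/square_mid E1 /square_mid E2]]]].
exact: inverse_cells_iso E1 E2.
Qed.

Lemma left_precompanionP (x y : Dbl ch) (f : hor x y) :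
  left_precompanion f <-> has_left_inverse (phi (mid f)).
Proof.
split=> [[x' [y' [z [f' [r [v [w [a [/vertically_invertible_iso[i]]]]]]]]]]|[g [i]]].
  (* The marks are generalized so that all vertical equalities can be substituted; then [phi_app]
     exhibits the composite of [r] as a left inverse. *)
  move/companion_iso=> [u [j]]; clear a; move: i u j => /=.
  move: (mid f) (mid f') (mid r) v w; rewrite /=.
  move: (mark x) (mark y) (mark x') (mark y') (mark z).
  move=> A C A' C' E p p' q v w i u j.
  subst A' C' E; apply: (left_inverse_iso i); exists (phi q); constructor.
  exact: (iso_cat (iso_inv j) (phi_app ch p' q)).
(* On the path [p] followed by [g], the segment [p] replaces [f] and [g] is the arrow [r]. Cells see
   only the marked segment, so the identity 2-cell compares [f] with its replacement. *)
pose p := mid f; pose q := pcons g (pnil (mark x)).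
exists (MarkedPath (pnil _) (papp p q)), (MarkedPath p q), (MarkedPath (papp p q) (pnil _)).
exists (dm_of (pnil _) p q), (dm_of p q (pnil _)), eq_refl, eq_refl, (id2 (phi p)).
split.
  exists eq_refl, eq_refl, (id2 (phi p)).
  by split; apply: dbl_cell_eq; congr Square; apply: vcomp1l.
apply: iso_one_companion; apply: (iso_cat i).
exact: (iso_cat (iso_whisk (phi_arrow g) (iso_id _)) (iso_inv (phi_app ch p q))).
Qed.

Lemma right_precompanionP (x y : Dbl ch) (f : hor x y) :
  right_precompanion f <-> has_right_inverse (phi (mid f)).
Proof.
split=> [[x' [y' [z [f' [l [v [w [a [/vertically_invertible_iso[i]]]]]]]]]]|[g [i]]].
  move/companion_iso=> [u [j]]; clear a; move: i u j => /=.
  move: (mid f) (mid f') (mid l) v w; rewrite /=.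
  move: (mark x) (mark y) (mark x') (mark y') (mark z).
  move=> A C A' C' E p p' q v w i u j.
  subst A' C' E; apply: (right_inverse_iso i); exists (phi q); constructor.
  exact: (iso_cat (iso_inv j) (phi_app ch q p')).
(* Dually, [g] now precedes [p]. The trailing [pnil] makes the two segments meet in definitionally
   the same marked path. *)
pose p := mid f; pose q := pcons g (pnil (mark x)).
exists (MarkedPath q (papp p (pnil _))), (MarkedPath (papp q p) (pnil _)).
exists (MarkedPath (pnil _) (papp q (papp p (pnil _)))).
exists (dm_of q p (pnil _)), (dm_of (pnil _) q (papp p (pnil _))).
exists eq_refl, eq_refl, (id2 (phi p)); split.
  exists eq_refl, eq_refl, (id2 (phi p)).
  by split; apply: dbl_cell_eq; congr Square; apply: vcomp1l.
apply: iso_one_companion; apply: (iso_cat i).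
exact: (iso_cat (iso_whisk (iso_id _) (phi_arrow g)) (iso_inv (phi_app ch q p))).
Qed.

End DblPrecompanions.

Theorem lemma4p5 (C : Category) (W : arrow_class C)
    (hCF1 : CF1 W) (hCF2 : CF2 W) (hCF3 : CF3 W)
    (D : Bicategory) (F : Homomorphism (locally_discrete C) D)
    (chC : choice_of_composites (locally_discrete C))
    (chD : choice_of_composites D) :
  W_homomorphism W F <->
  (forall (x y : Dbl chC) (f : hor x y),
     W_doubly_marked W f -> precompanion (Dh (DblF F chC chD) f)).
Proof.
split=> [HF x y f Wf|H A B w Ww].
  have /internal_equivalenceP[l r] := HF _ _ _ Wf.
  (* The chosen composite of the images is compared with the image of an arrow of [W], on which [F]
     is an equivalence. *)
  have i : iso2 (phi chD (mid (Dh (DblF F chC chD) f))) (F1 F (path_comp (mid f))).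
    exact: (iso_cat (F_path_comp F (mid f)) (phi_norm chD _)).
  split.
    by apply/left_precompanionP; apply: left_inverse_iso i l.
  by apply/right_precompanionP; apply: right_inverse_iso i r.
(* The hypothesis is applied to the path consisting of [w] alone, marked at both ends. *)
have [|/left_precompanionP l /right_precompanionP r] :=
  H _ _ (@dm_of (locally_discrete C) A A B B
           (pnil A) (pcons (w : @hom (locally_discrete C) A B) (pnil B)) (pnil B)).
  by rewrite /W_doubly_marked /= ccomp1l.
apply/(internal_equivalence_iso (iso_inv (phi_arrow chD _))).
exact/internal_equivalenceP.
Qed.
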